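(* Locational uniform pricing for energy. Consider the scenario-oriented energy-reserve co-optimization model (II) described in the context, under the assumptions (i)-(vi) listed there, and let the marginal energy prices $\eta^g(\cdot)$ of generators and $\eta^d(\cdot)$ of loads be defined, as in the context, as sensitivities of the optimal cost of the modified model (III). Let $i,j$ be any two generators and $l$ any load at the same bus, i.e. $m_i=m_j=m_l$. Then they have the same energy price: $$\eta^g(i)=\eta^g(j)=\eta^d(l).$$
   Context: Assumptions. (i) A shift-factor-based lossless DC optimal power flow model with linear cost functions for energy and reserve is used. (ii) The problem is single-period. (iii) Renewable generations are modelled as negative loads. (iv) Non-base scenarios may have line outages, load or renewable power fluctuations, etc., but no generator outages. (v) The model guards against a set $\mathcal K$ of mutually exclusive non-base scenarios with given occurrence probabilities $\epsilon_k$, $k\in\mathcal K$. (vi) $\sum_{k\in\mathcal K}\overline{\tau}_k^*(l)=0$ for the loads $l$, where $\overline{\tau}_k$ is the multiplier of the load-shedding upper bound below. Model (II). Generator $j$ is located at bus $m_j$ and load $l$ at bus $m_l$. Decision variables: generation $g$, upward reserve $r_U$, downward reserve $r_D$ (vectors over generators), and for each $k\in\mathcal K$ upward and downward re-dispatch $\delta g^U_k,\delta g^D_k$ (over generators) and load shedding $\delta d_k$ (over loads). Data: bid-in prices $c_g,c_U,c_D$ of energy, upward and downward reserve; re-dispatch prices $\overline c,\underline c$; load-shedding prices $c_L$; base load $d$; load fluctuation $\pi_k$ (with $d+\pi_k\ge 0$); generation bounds $\underline G,\overline G$; reserve bounds $\overline{r_U},\overline{r_D}$; line limits $f$ (base case)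 and $f_k$ (scenario $k$); shift-factor matrices $S_G,S_D$ (base case) and $S_{G,k},S_{D,k}$ (scenario $k$) for generators and loads. Model (II) is the linear program $$\min\; F=c_g^Tg+c_U^Tr_U+c_D^Tr_D+\sum_{k\in\mathcal K}\epsilon_k(\overline c^T\delta g^U_k-\underline c^T\delta g^D_k+c_L^T\delta d_k)$$ subject to (multipliers in front) $(\lambda,\mu)$: $\mathbf 1^Tg=\mathbf 1^Td$, $S_Gg-S_Dd\le f$; $(\underline\upsilon,\overline\upsilon)$: $\underline G+r_D\le g$, $g+r_U\le\overline G$; $(\underline{\rho^U},\overline{\rho^U},\underline{\rho^D},\overline{\rho^D})$: $0\le r_U\le\overline{r_U}$, $0\le r_D\le\overline{r_D}$; and for all $k\in\mathcal K$: $\lambda_k$: $\mathbf 1^T(g+\delta g^U_k-\delta g^D_k)=\mathbf 1^T(d+\pi_k-\delta d_k)$; $\mu_k$: $S_{G,k}(g+\delta g^U_k-\delta g^D_k)-S_{D,k}(d+\pi_k-\delta d_k)\le f_k$; $(\underline{\alpha_k},\overline{\alpha_k})$: $0\le\delta g^U_k\le r_U$; $(\underline{\beta_k},\overline{\beta_k})$: $0\le\delta g^D_k\le r_D$; $(\underline{\tau_k},\overline{\tau_k})$: $0\le\delta d_k\le d+\pi_k$. Sign convention: the Lagrangian is $F$ plus $\lambda(\mathbf 1^Td-\mathbf 1^Tg)$, plus $\lambda_k(\mathbf 1^T(d+\pi_k-\delta d_k)-\mathbf 1^T(g+\delta g^U_k-\delta g^D_k))$ for each $k$, plus, for each inequality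 $a\le b$, its nonnegative multiplier times $(a-b)$. Superscript $*$ denotes values at an optimal primal solution of (II) and associated optimal multipliers. Shift factors depend only on the bus: $S_G(\cdot,m_j)$ is the column of $S_G$ for a generator at bus $m_j$, $S_D(\cdot,m_l)$ is the column of $S_D$ for a load at bus $m_l$, and $S_G(\cdot,m)=S_D(\cdot,m)$ for a common bus $m$; likewise for $S_{G,k},S_{D,k}$. Model (III) (for a given generator $j$). Fix $g(j),r_U(j),r_D(j)$ at their optimal values $g^*(j),r_U^*(j),r_D^*(j)$ in (II) and regard them as parameters instead of decision variables. Let $x_{-j}$ be all decision variables of (II) except $g(j),r_U(j),r_D(j)$; let $F_{-j}(x_{-j})$ be the overall cost $F$ excluding the bid-in cost $c_g(j)g(j)+c_U(j)r_U(j)+c_D(j)r_D(j)$ of generator $j$; and let $\mathcal X_{-j}$ be the feasible set given by all constraints of (II) except generator $j$'s internal constraints, i.e. the $j$-th rows of $\underline G+r_D\le g$, $g+r_U\le\overline G$, $0\le r_U\le\overline{r_U}$, $0\le r_D\le\overline{r_D}$. Model (III) is $\min_{x_{-j}\in\mathcal X_{-j}}F_{-j}(x_{-j})$, with optimal value $F_{-j}(x_{-j}^* )$, which depends on the parameters $g(j),r_U(j),r_D(j)$ and on $d$. The starred values of (II), with generator $j$'s fixed variables and the multipliers of its internal constraints dropped, are an optimal primal-dual solution of (III). Energy prices (definition). The marginal energy price of generator $j$ is the negative sensitivity of this optimal value to $g(j)$, and the marginal energy price of load $l$ is its sensitivity to $d(l)$ (with (III) formed for any generator $j$); by the envelope theorem,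 $$\eta^g(j)=-\frac{\partial F_{-j}(x_{-j}^* )}{\partial g(j)}=\lambda^*-S_G(\cdot,m_j)^T\mu^*+\sum_{k\in\mathcal K}(\lambda_k^*-S_{G,k}(\cdot,m_j)^T\mu_k^* )=\omega_0(m_j)+\sum_{k\in\mathcal K}\omega_k(m_j),$$ $$\eta^d(l)=\frac{\partial F_{-j}(x_{-j}^* )}{\partial d(l)}=\lambda^*-S_D(\cdot,m_l)^T\mu^*+\sum_{k\in\mathcal K}(\lambda_k^*-S_{D,k}(\cdot,m_l)^T\mu_k^*-\overline{\tau}_k^*(l))=\omega_0(m_l)+\sum_{k\in\mathcal K}\omega_k(m_l)-\sum_{k\in\mathcal K}\overline{\tau}_k^*(l),$$ where, for a bus $m$, $\omega_0(m)=\lambda^*-S_G(\cdot,m)^T\mu^*$ and $\omega_k(m)=\lambda_k^*-S_{G,k}(\cdot,m)^T\mu_k^*$ (with $S_D,S_{D,k}$ giving the same values). As implicit in the use of the envelope theorem, these partial derivatives are taken to exist. *)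

(* Defs.v *)
From HB Require Import structures.
From mathcomp Require Import all_boot all_order all_algebra.
From mathcomp Require Import all_classical all_reals all_analysis.

Set Implicit Arguments.
Unset Strict Implicit.
Unset Printing Implicit Defensive.

Import Order.TTheory GRing.Theory Num.Theory.
Import numFieldNormedType.Exports.
Local Open Scope classical_set_scope.
Local Open Scope ring_scope.

Section ColumnVectors.
Context {R : realType}.

Definition le_cv {n} (u v : 'cV[R]_n) : Prop := forall i, u i 0 <= v i 0.

Definition dot {n} (u v : 'cV[R]_n) : R := \sum_i u i 0 * v i 0.

Definition total {n} (u : 'cV[R]_n) : R := \sum_i u i 0.

Definition upd {n} (u : 'cV[R]_n) (l : 'I_n) (t : R) : 'cV[R]_n :=
  \col_i (if i == l then t else u i 0).

End ColumnVectors.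

(* All the data except the base load, which is kept as a separate argument
   because optimal values are differentiated with respect to it.
   [K] indexes the non-base scenarios; [nT] is the number of line constraints
   of the base case and [nTk k] the number of those of scenario [k]. *)
Record model (R : realType) (bus K : finType) (nG nL nT : nat)
    (nTk : K -> nat) := Model {
  gen_bus : 'I_nG -> bus;
  load_bus : 'I_nL -> bus;
  c_g : 'cV[R]_nG;
  c_U : 'cV[R]_nG;
  c_D : 'cV[R]_nG;
  c_up : 'cV[R]_nG;              (* upward re-dispatch *)
  c_dn : 'cV[R]_nG;              (* downward re-dispatch *)
  c_L : 'cV[R]_nL;
  prob : K -> R;
  fluct : K -> 'cV[R]_nL;
  G_min : 'cV[R]_nG;
  G_max : 'cV[R]_nG;
  rU_max : 'cV[R]_nG;
  rD_max : 'cV[R]_nG;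
  flim : 'cV[R]_nT;
  flimk : forall k, 'cV[R]_(nTk k);
  S_G : 'M[R]_(nT, nG);
  S_D : 'M[R]_(nT, nL);
  S_Gk : forall k, 'M[R]_(nTk k, nG);
  S_Dk : forall k, 'M[R]_(nTk k, nL)
}.

Record primal (R : realType) (K : finType) (nG nL : nat) := Primal {
  gen : 'cV[R]_nG;
  rU : 'cV[R]_nG;
  rD : 'cV[R]_nG;
  dgU : K -> 'cV[R]_nG;
  dgD : K -> 'cV[R]_nG;
  dd : K -> 'cV[R]_nL
}.

Record multipliers (R : realType) (K : finType) (nG nL nT : nat)
    (nTk : K -> nat) := Multipliers {
  lam : R;
  mu : 'cV[R]_nT;
  ups_lo : 'cV[R]_nG;
  ups_up : 'cV[R]_nG;
  rhoU_lo : 'cV[R]_nG;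
  rhoU_up : 'cV[R]_nG;
  rhoD_lo : 'cV[R]_nG;
  rhoD_up : 'cV[R]_nG;
  lamk : K -> R;
  muk : forall k, 'cV[R]_(nTk k);
  alpha_lo : K -> 'cV[R]_nG;
  alpha_up : K -> 'cV[R]_nG;
  beta_lo : K -> 'cV[R]_nG;
  beta_up : K -> 'cV[R]_nG;
  tau_lo : K -> 'cV[R]_nL;
  tau_up : K -> 'cV[R]_nL
}.

Arguments model : clear implicits.
Arguments primal : clear implicits.
Arguments multipliers : clear implicits.

Section CoOptimization.
Context {R : realType} {bus K : finType} {nG nL nT : nat} {nTk : K -> nat}.
Variable D : model R bus K nG nL nT nTk.
Implicit Types (d : 'cV[R]_nL) (x : primal R K nG nL).
Implicit Types (y : multipliers R K nG nL nT nTk) (j : 'I_nG) (l : 'I_nL).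

Definition columns_by_bus (n : nat) (SG : 'M[R]_(n, nG)) (SD : 'M[R]_(n, nL))
    : Prop :=
  [/\ forall i j, gen_bus D i = gen_bus D j -> col i SG = col j SG,
      forall l l', load_bus D l = load_bus D l' -> col l SD = col l' SD
    & forall j l, gen_bus D j = load_bus D l -> col j SG = col l SD].

Definition shift_factors_by_bus : Prop :=
  columns_by_bus (S_G D) (S_D D)
  /\ forall k, columns_by_bus (S_Gk D k) (S_Dk D k).

(* The scenarios are mutually exclusive, hence the bound on the sum; the
   remaining probability is that of the base case. *)
Definition valid_probabilities : Prop :=
  (forall k, 0 <= prob D k) /\ \sum_k prob D k <= 1.

Definition cost x : R :=
  dot (c_g D) (gen x) + dot (c_U D) (rU x) + dot (c_D D) (rD x)
  + \sum_k prob D k * (dot (c_up D) (dgU x k) - dot (c_dn D) (dgD x k)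
                       + dot (c_L D) (dd x k)).

Definition genk x k : 'cV[R]_nG := gen x + dgU x k - dgD x k.
Definition loadk d x k : 'cV[R]_nL := d + fluct D k - dd x k.

Definition scenario_constraints d x k : Prop :=
  [/\ total (genk x k) = total (loadk d x k),
      le_cv (S_Gk D k *m genk x k - S_Dk D k *m loadk d x k) (flimk D k),
      le_cv 0 (dgU x k) /\ le_cv (dgU x k) (rU x),
      le_cv 0 (dgD x k) /\ le_cv (dgD x k) (rD x)
    & le_cv 0 (dd x k) /\ le_cv (dd x k) (d + fluct D k)].

Definition noninternal_constraints d x : Prop :=
  [/\ total (gen x) = total d,
      le_cv (S_G D *m gen x - S_D D *m d) (flim D)
    & forall k, scenario_constraints d x k].

Definition internal_constraints x j : Prop :=
  [/\ G_min D j 0 + rD x j 0 <= gen x j 0,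
      gen x j 0 + rU x j 0 <= G_max D j 0,
      0 <= rU x j 0 <= rU_max D j 0
    & 0 <= rD x j 0 <= rD_max D j 0].

(* Model (II) *)
Definition feasible d x : Prop :=
  noninternal_constraints d x /\ forall j, internal_constraints x j.

Definition optimal d x : Prop :=
  feasible d x /\ forall x', feasible d x' -> cost x <= cost x'.

Definition lagrangian d x y : R :=
  cost x
  + lam y * (total d - total (gen x))
  + dot (mu y) (S_G D *m gen x - S_D D *m d - flim D)
  + dot (ups_lo y) (G_min D + rD x - gen x)
  + dot (ups_up y) (gen x + rU x - G_max D)
  + dot (rhoU_lo y) (0 - rU x)
  + dot (rhoU_up y) (rU x - rU_max D)
  + dot (rhoD_lo y) (0 - rD x)
  + dot (rhoD_up y) (rD x - rD_max D)
  + \sum_k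
    (lamk y k * (total (loadk d x k) - total (genk x k))
     + dot (muk y k)
         (S_Gk D k *m genk x k - S_Dk D k *m loadk d x k - flimk D k)
     + dot (alpha_lo y k) (0 - dgU x k)
     + dot (alpha_up y k) (dgU x k - rU x)
     + dot (beta_lo y k) (0 - dgD x k)
     + dot (beta_up y k) (dgD x k - rD x)
     + dot (tau_lo y k) (0 - dd x k)
     + dot (tau_up y k) (dd x k - (d + fluct D k))).

Definition dual_nonneg y : Prop :=
  [/\ le_cv 0 (mu y),
      le_cv 0 (ups_lo y) /\ le_cv 0 (ups_up y),
      le_cv 0 (rhoU_lo y) /\ le_cv 0 (rhoU_up y),
      le_cv 0 (rhoD_lo y) /\ le_cv 0 (rhoD_up y)
    & forall k,
        [/\ le_cv 0 (muk y k),
            le_cv 0 (alpha_lo y k) /\ le_cv 0 (alpha_up y k),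
            le_cv 0 (beta_lo y k) /\ le_cv 0 (beta_up y k)
          & le_cv 0 (tau_lo y k) /\ le_cv 0 (tau_up y k)]].

Definition complementary_slackness d x y : Prop :=
  [/\ dot (mu y) (S_G D *m gen x - S_D D *m d - flim D) = 0,
      dot (ups_lo y) (G_min D + rD x - gen x) = 0
      /\ dot (ups_up y) (gen x + rU x - G_max D) = 0,
      dot (rhoU_lo y) (0 - rU x) = 0
      /\ dot (rhoU_up y) (rU x - rU_max D) = 0,
      dot (rhoD_lo y) (0 - rD x) = 0
      /\ dot (rhoD_up y) (rD x - rD_max D) = 0
    & forall k,
        [/\ dot (muk y k)
              (S_Gk D k *m genk x k - S_Dk D k *m loadk d x k - flimk D k) = 0,
            dot (alpha_lo y k) (0 - dgU x k) = 0
            /\ dot (alpha_up y k) (dgU x k - rU x) = 0,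
            dot (beta_lo y k) (0 - dgD x k) = 0
            /\ dot (beta_up y k) (dgD x k - rD x) = 0
          & dot (tau_lo y k) (0 - dd x k) = 0
            /\ dot (tau_up y k) (dd x k - (d + fluct D k)) = 0]].

(* Stationarity is stated as minimality of the Lagrangian over all primal
   points (feasible or not); the Lagrangian being affine in [x], this says that
   its gradient in [x] vanishes. *)
Definition optimal_multipliers d x y : Prop :=
  [/\ dual_nonneg y,
      forall x', lagrangian d x y <= lagrangian d x' y
    & complementary_slackness d x y].

Definition optimal_primal_dual d x y : Prop :=
  optimal d x /\ optimal_multipliers d x y.

(* Model (III): points of model (III) for generator [j] are encoded as full
   primal points whose [j]-th generation and reserves are pinned to the
   parameters [pg], [pU], [pD]. *)
Definition cost_except j x : R :=
  cost x - (c_g D j 0 * gen x j 0 + c_U D j 0 * rU x j 0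
            + c_D D j 0 * rD x j 0).

Definition feasible_except j (pg pU pD : R) d : set (primal R K nG nL) :=
  [set x | [/\ [/\ gen x j 0 = pg, rU x j 0 = pU & rD x j 0 = pD],
               noninternal_constraints d x
             & forall i, i != j -> internal_constraints x i]].

(* +oo when model (III) is infeasible, -oo when it is unbounded. *)
Definition value_except j (pg pU pD : R) d : \bar R :=
  ereal_inf [set (cost_except j x)%:E | x in feasible_except j pg pU pD d].

(* The finiteness requirement is needed because [fine] sends infinities to 0. *)
Definition has_sensitivity (v : R -> \bar R) (p : R) : Prop :=
  (\forall t \near p, v t \is a fin_num) /\ derivable (fine \o v) p 1.

Definition sensitivity (v : R -> \bar R) (p : R) : R := derive1 (fine \o v) p.

Definition value_of_gen d x j : R -> \bar R :=
  fun t => value_except j t (rU x j 0) (rD x j 0) d.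

Definition value_of_load d x j l : R -> \bar R :=
  fun t => value_except j (gen x j 0) (rU x j 0) (rD x j 0) (upd d l t).

(* Marginal energy prices; [x] is the optimal solution of model (II), and in
   the price of load [l] model (III) is formed for generator [j]. *)
Definition has_eta_g d x j : Prop :=
  has_sensitivity (value_of_gen d x j) (gen x j 0).
Definition eta_g d x j : R :=
  - sensitivity (value_of_gen d x j) (gen x j 0).

Definition has_eta_d d x j l : Prop :=
  has_sensitivity (value_of_load d x j l) (d l 0).
Definition eta_d d x j l : R :=
  sensitivity (value_of_load d x j l) (d l 0).

End CoOptimization.

(* Main.v *)
(** A feasible point of model (III) for a perturbed parameter has cost at least
    the Lagrangian of (II) minus the (nonpositive) penalty terms.  The Lagrangian
    is bounded below by the optimal cost, and moving g(j) or d(l) changes it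
    through the noninternal penalty terms by exactly the nodal price times the
    displacement.  Hence the optimal value of (III) has an affine minorant that
    touches it at the unperturbed parameter, so where it is differentiable its
    derivative is the slope of that minorant.  This slope depends on the bus only,
    up to the load-shedding multipliers, whose sum vanishes. *)

Require Import Defs.
From HB Require Import structures.
From mathcomp Require Import all_boot all_order all_algebra.
From mathcomp Require Import all_classical all_reals all_analysis.
From mathcomp Require Import ring lra.
(* [total] must denote the sum of entries again, not ssrbool's totality. *)
Import Defs.

Set Implicit Arguments.
Unset Strict Implicit.
Unset Printing Implicit Defensive.

Import Order.TTheory GRing.Theory Num.Theory.
Import numFieldNormedType.Exports.
Local Open Scope classical_set_scope.
Local Open Scope ring_scope.

(** * Derivatives of functions touched from below by an affine function *)

Lemma derive1_affine_minorant (R : realType) (f : R -> R) (p a : R) :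
  derivable f p 1 -> (\forall t \near p, f p + a * (t - p) <= f t) ->
  derive1 f p = a.
Proof.
move=> df minorant; rewrite derive1E.
have shifted : \forall h \near (0 : R), a * h <= f (h + p) - f p.
  move: minorant; rewrite (near_shift 0); apply: filterS => h /=.
  by rewrite subr0 addrK lerBrDl.
(* Dividing by [h] reverses [shifted] for [h < 0] and preserves it for [h > 0]: left difference
   quotients are at most [a], right ones at least [a], and both tend to the derivative. *)
apply/eqP; rewrite eq_le; apply/andP; split.
- rewrite ['D_1 f p]cvg_at_leftE //; apply: limr_le.
    apply: cvgP; apply: cvg_trans df; apply: cvg_app.
    move=> A [e e0 Ae]; exists e => // h he h0; apply: Ae => //.
    exact/ltr0_neq0.
  near=> h; have h0 : h < 0 by near: h; exists 1 => /=.
  rewrite [_ *: _]mulrC ler_ndivrMr // [_%:A]mulr1.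
  by near: h; case: shifted => e e0 He; exists e => // h' ? _; exact: He.
- rewrite ['D_1 f p]cvg_at_rightE //; apply: limr_ge.
    apply: cvgP; apply: cvg_trans df; apply: cvg_app.
    move=> A [e e0 Ae]; exists e => // h he h0; apply: Ae => //.
    exact/lt0r_neq0.
  near=> h; have h0 : 0 < h by near: h; exists 1 => /=.
  rewrite [_ *: _]mulrC ler_pdivlMr // [_%:A]mulr1.
  by near: h; case: shifted => e e0 He; exists e => // h' ? _; exact: He.
Unshelve. all: by end_near. Qed.

Lemma sensitivity_affine_minorant (R : realType) (v : R -> \bar R) (p c a : R) :
  has_sensitivity v p -> (v p <= c%:E)%E ->
  (forall t, ((c + a * (t - p))%:E <= v t)%E) -> sensitivity v p = a.
Proof.
move=> [vfin dv] vpc minorant; apply: derive1_affine_minorant => //=.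
(* The minorant at [p] itself equals [c], so together with the upper bound it pins [v p]. *)
have vp : v p = c%:E.
  apply/eqP; rewrite eq_le vpc /=.
  by have := minorant p; rewrite subrr mulr0 addr0.
rewrite vp /=; apply: filterS vfin => t vt.
by rewrite -lee_fin fineK.
Qed.

Lemma addr_le0 (R : numDomainType) (a b : R) : a <= 0 -> b <= 0 -> a + b <= 0.
Proof. by move=> a0 b0; rewrite -[leRHS]addr0 lerD. Qed.

(** * Linear forms on column vectors and changes of a single entry *)

Section ColumnVectorFacts.
Context {R : realType}.

Lemma dotDr n (u v w : 'cV[R]_n) : dot u (v + w) = dot u v + dot u w.
Proof.
by rewrite /dot -big_split; apply: eq_bigr => i _; rewrite mxE mulrDr.
Qed.

Lemma dotZr n (u v : 'cV[R]_n) a : dot u (a *: v) = a * dot u v.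
Proof.
by rewrite /dot mulr_sumr; apply: eq_bigr => i _; rewrite mxE mulrCA.
Qed.

Lemma dotNr n (u v : 'cV[R]_n) : dot u (- v) = - dot u v.
Proof. by rewrite -scaleN1r dotZr mulN1r. Qed.

Lemma dot_le0 n (u v : 'cV[R]_n) : le_cv 0 u -> le_cv v 0 -> dot u v <= 0.
Proof.
move=> u0 v0; apply: sumr_le0 => i _.
by have := u0 i; have := v0 i; rewrite !mxE => ? ?; apply: mulr_ge0_le0.
Qed.

Lemma dot_subr_le0 n (u v w : 'cV[R]_n) :
  le_cv 0 u -> le_cv v w -> dot u (v - w) <= 0.
Proof.
by move=> u0 vw; apply: dot_le0 => // i; rewrite !mxE subr_le0.
Qed.

Lemma totalD n (u v : 'cV[R]_n) : total (u + v) = total u + total v.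
Proof.
by rewrite /total -big_split; apply: eq_bigr => i _; rewrite mxE.
Qed.

(** As a multiple of a basis vector added to [u], an update acts additively on [total], [dot] and
    matrix products. *)
Lemma updE n (u : 'cV[R]_n) l t :
  upd u l t = u + (t - u l 0) *: delta_mx l 0.
Proof.
apply/colP => i; rewrite !mxE eqxx andbT.
by case: eqVneq => [->|_] /=; rewrite ?mulr1 ?mulr0 ?addr0 // addrC subrK.
Qed.

Lemma total_delta n (l : 'I_n) a : total (a *: delta_mx l 0 : 'cV[R]_n) = a.
Proof.
rewrite /total (bigD1 l) //= !mxE !eqxx mulr1 big1 ?addr0 // => i /negbTE il.
by rewrite !mxE il mulr0.
Qed.

Lemma dot_delta n (c : 'cV[R]_n) l a : dot c (a *: delta_mx l 0) = c l 0 * a.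
Proof.
rewrite /dot (bigD1 l) //= !mxE !eqxx mulr1 big1 ?addr0 // => i /negbTE il.
by rewrite !mxE il !mulr0.
Qed.

Lemma mulmx_delta m n (M : 'M[R]_(m, n)) l a :
  M *m (a *: delta_mx l 0 : 'cV_n) = a *: col l M.
Proof. by rewrite -scalemxAr -colE. Qed.

End ColumnVectorFacts.

(** * Nodal prices and the two halves of the Lagrangian *)

Section Prices.
Context {R : realType} {bus K : finType} {nG nL nT : nat} {nTk : K -> nat}.
Variable D : model R bus K nG nL nT nTk.
Implicit Types (d : 'cV[R]_nL) (x : primal R K nG nL).
Implicit Types (y : multipliers R K nG nL nT nTk) (j : 'I_nG) (l : 'I_nL).

(** The nodal sum $\omega_0+\sum_k\omega_k$ at the bus of [j], which the envelope theorem predicts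
    for the price. *)
Definition gen_price y j : R :=
  lam y - dot (mu y) (col j (S_G D))
  + \sum_k (lamk y k - dot (muk y k) (col j (S_Gk D k))).

Definition load_price y l : R :=
  lam y - dot (mu y) (col l (S_D D))
  + \sum_k (lamk y k - dot (muk y k) (col l (S_Dk D k)) - tau_up y k l 0).

Lemma gen_price_bus y i j : shift_factors_by_bus D ->
  gen_bus D i = gen_bus D j -> gen_price y i = gen_price y j.
Proof.
case=> -[SG _ _] Sk ij; rewrite /gen_price (SG _ _ ij).
by congr (_ + _); apply: eq_bigr => k _; have [/(_ _ _ ij) ->] := Sk k.
Qed.

Lemma gen_load_price_bus y j l : shift_factors_by_bus D ->
  \sum_k tau_up y k l 0 = 0 ->
  gen_bus D j = load_bus D l -> gen_price y j = load_price y l.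
Proof.
case=> -[_ _ SGD] Sk tau0 jl; rewrite /gen_price /load_price (SGD _ _ jl).
rewrite [in RHS]sumrB tau0 subr0.
by congr (_ + _); apply: eq_bigr => k _; have [_ _ /(_ _ _ jl) ->] := Sk k.
Qed.

(** The Lagrangian is split so that its two penalty halves can be bounded at different primal
    points. *)
Definition noninternal_penalty d x y : R :=
  lam y * (total d - total (gen x))
  + dot (mu y) (S_G D *m gen x - S_D D *m d - flim D)
  + \sum_k
    (lamk y k * (total (loadk D d x k) - total (genk x k))
     + dot (muk y k)
         (S_Gk D k *m genk x k - S_Dk D k *m loadk D d x k - flimk D k)
     + dot (alpha_lo y k) (0 - dgU x k)
     + dot (alpha_up y k) (dgU x k - rU x)
     + dot (beta_lo y k) (0 - dgD x k)
     + dot (beta_up y k) (dgD x k - rD x)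
     + dot (tau_lo y k) (0 - dd x k)
     + dot (tau_up y k) (dd x k - (d + fluct D k))).

Definition internal_penalty x y : R :=
  dot (ups_lo y) (G_min D + rD x - gen x)
  + dot (ups_up y) (gen x + rU x - G_max D)
  + dot (rhoU_lo y) (0 - rU x)
  + dot (rhoU_up y) (rU x - rU_max D)
  + dot (rhoD_lo y) (0 - rD x)
  + dot (rhoD_up y) (rD x - rD_max D).

Lemma lagrangianE d x y :
  lagrangian D d x y
  = cost D x + noninternal_penalty d x y + internal_penalty x y.
Proof. by rewrite /lagrangian /noninternal_penalty /internal_penalty; ring. Qed.

Lemma noninternal_penalty_le0 d x y : dual_nonneg y ->
  noninternal_constraints D d x -> noninternal_penalty d x y <= 0.
Proof.
case=> mu0 _ _ _ y0 [bal line scen]; rewrite /noninternal_penalty.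
rewrite -bal subrr mulr0 add0r.
apply: addr_le0; first exact: dot_subr_le0.
apply: sumr_le0 => k _.
have [balk linek [U0 U1] [D0 D1] [d0 d1]] := scen k.
have [? [? ?] [? ?] [? ?]] := y0 k.
rewrite balk subrr mulr0 add0r.
by do !apply: addr_le0; apply: dot_subr_le0.
Qed.

Lemma internal_penalty_le0 x y : dual_nonneg y ->
  (forall j, internal_constraints D x j) -> internal_penalty x y <= 0.
Proof.
case=> _ [? ?] [? ?] [? ?] _ int.
have H1 : le_cv (G_min D + rD x) (gen x).
  by move=> j; rewrite !mxE; case: (int j).
have H2 : le_cv (gen x + rU x) (G_max D).
  by move=> j; rewrite !mxE; case: (int j).
have H3 : le_cv 0 (rU x) by move=> j; rewrite mxE; case: (int j) => _ _ /andP[].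
have H4 : le_cv (rU x) (rU_max D) by move=> j; case: (int j) => _ _ /andP[].
have H5 : le_cv 0 (rD x) by move=> j; rewrite mxE; case: (int j) => _ _ _ /andP[].
have H6 : le_cv (rD x) (rD_max D) by move=> j; case: (int j) => _ _ _ /andP[].
rewrite /internal_penalty.
by do !apply: addr_le0; apply: dot_subr_le0.
Qed.

Lemma lagrangian_optimal d x y :
  feasible D d x -> complementary_slackness D d x y ->
  lagrangian D d x y = cost D x.
Proof.
move=> [[bal _ scen] _] [e1 [e2 e3] [e4 e5] [e6 e7] ek].
rewrite /lagrangian e1 e2 e3 e4 e5 e6 e7 bal subrr mulr0 !addr0 big1 ?addr0 //.
move=> k _; have [balk _ _ _ _] := scen k.
have [-> [-> ->] [-> ->] [-> ->]] := ek k.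
by rewrite balk subrr mulr0 !addr0.
Qed.

Definition set_gen x j s : primal R K nG nL :=
  Primal (upd (gen x) j s) (rU x) (rD x) (dgU x) (dgD x) (dd x).

Lemma noninternal_penalty_set_gen d x y j s :
  noninternal_penalty d (set_gen x j s) y
  = noninternal_penalty d x y - (s - gen x j 0) * gen_price y j.
Proof.
(* Pairs the price terms with the base case and with each scenario, so that the identity is checked
   term by term. *)
rewrite /noninternal_penalty /gen_price [_ * (_ + \sum_k _)]mulrDr mulr_sumr
  opprD addrACA -sumrB.
congr (_ + _); last apply: eq_bigr => k _;
  rewrite /genk /loadk /= updE; set a := s - _.
- rewrite totalD total_delta mulmxDr mulmx_delta !(dotDr, dotNr) dotZr; ring.
- rewrite !(mulmxDr, mulmxN) mulmx_delta !(dotDr, dotNr) dotZr.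
  rewrite !totalD total_delta; ring.
Qed.

(** Besides balances and line flows, $d(l)$ enters the shedding bound, whence the [tau_up] term of
    [load_price]. *)
Lemma noninternal_penalty_upd d x y l t :
  noninternal_penalty (upd d l t) x y
  = noninternal_penalty d x y + (t - d l 0) * load_price y l.
Proof.
rewrite /noninternal_penalty /load_price [_ * (_ + \sum_k _)]mulrDr mulr_sumr
  addrACA -big_split.
congr (_ + _); last apply: eq_bigr => k _;
  rewrite /genk /loadk /= updE; set a := t - _.
- rewrite totalD total_delta mulmxDr mulmx_delta !(dotDr, dotNr) dotZr; ring.
- rewrite !(mulmxDr, mulmxN) mulmx_delta !(opprD, dotDr, dotNr) dot_delta dotZr.
  rewrite !totalD total_delta; ring.
Qed.

Lemma cost_except_set_gen x j s :
  cost_except D j (set_gen x j s) = cost_except D j x.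
Proof.
rewrite /cost_except /cost /= updE dotDr dot_delta !mxE !eqxx /=; ring.
Qed.

(** * Prices as sensitivities at an optimum *)

Section Optimum.
Variables (d : 'cV[R]_nL) (x : primal R K nG nL).
Variable y : multipliers R K nG nL nT nTk.
Hypothesis Hopt : optimal_primal_dual D d x y.

(** Stationarity ranges over all primal points, so this bound also covers points feasible only for a
    perturbed model (III). *)
Lemma cost_optimal_le x' :
  cost D x <= cost D x' + noninternal_penalty d x' y + internal_penalty x' y.
Proof.
have [[feas _] [_ stat slack]] := Hopt.
by rewrite -lagrangianE -(lagrangian_optimal feas slack).
Qed.

Lemma value_except_le j :
  (value_except D j (gen x j 0)%R (rU x j 0)%R (rD x j 0)%R d
    <= (cost_except D j x)%:E)%E.
Proof.
have [[[non int] _] _] := Hopt.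
by apply: ereal_inf_lbound; exists x.
Qed.

Lemma eta_gE j : has_eta_g D d x j -> eta_g D d x j = gen_price y j.
Proof.
move=> sens; rewrite -[RHS]opprK; congr (- _).
apply: sensitivity_affine_minorant sens (value_except_le j) _ => t.
apply: le_ereal_inf_tmp => _ [x' [[gt rUt rDt] non int] <-]; rewrite lee_fin.
have [[[_ intx] _] [y0 _ _]] := Hopt.
(* Resetting g(j) to its optimal value restores the internal constraints of j. *)
pose x'' := set_gen x' j (gen x j 0).
have int'' i : internal_constraints D x'' i.
  have [->|ij] := eqVneq i j.
    by have := intx j; rewrite /internal_constraints /= rUt rDt !mxE eqxx.
  by have := int i ij; rewrite /internal_constraints /= !mxE (negbTE ij).
(* The internal half is bounded at [x''], the noninternal half at [x']; the shift between them
   yields the slope [- gen_price y j]. *)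
have := internal_penalty_le0 y0 int''.
have := noninternal_penalty_le0 y0 non.
have := cost_optimal_le x''.
rewrite noninternal_penalty_set_gen -(cost_except_set_gen x' j (gen x j 0)).
rewrite -/x'' /cost_except /= rUt rDt gt !mxE eqxx; lra.
Qed.

(** The slope does not involve [h]: the load's price is the same whichever generator model (III) is
    formed for. *)
Lemma eta_dE h l : has_eta_d D d x h l -> eta_d D d x h l = load_price y l.
Proof.
move=> sens; rewrite /eta_d.
apply: (sensitivity_affine_minorant (c := cost_except D h x) sens).
  rewrite /value_of_load (_ : upd d l (d l 0) = d) ?value_except_le //.
  by rewrite updE subrr scale0r addr0.
move=> t; apply: le_ereal_inf_tmp => _ [x' [[gt rUt rDt] non int] <-].
rewrite lee_fin.
have [[[_ intx] _] [y0 _ _]] := Hopt.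
(* All three parameters of [h] are pinned at their optimal values, so [x'] inherits the internal
   constraints of [h] from [x]. *)
have int' i : internal_constraints D x' i.
  have [->|/int //] := eqVneq i h.
  by have := intx h; rewrite /internal_constraints rUt rDt gt.
have := internal_penalty_le0 y0 int'.
have := noninternal_penalty_le0 y0 non.
have := cost_optimal_le x'.
rewrite noninternal_penalty_upd /cost_except rUt rDt gt; lra.
Qed.

End Optimum.
End Prices.

Theorem theorem1 (R : realType) (bus K : finType) (nG nL nT : nat)
    (nTk : K -> nat) (D : model R bus K nG nL nT nTk) (d : 'cV[R]_nL)
    (x : primal R K nG nL) (y : multipliers R K nG nL nT nTk)
    (Hprob : valid_probabilities D)
    (Hload : forall k, le_cv 0 (d + fluct D k))
    (Hshift : shift_factors_by_bus D)
    (Hopt : optimal_primal_dual D d x y)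
    (Htau : forall l : 'I_nL, \sum_k tau_up y k l 0 = 0)
    (i j h : 'I_nG) (l : 'I_nL)
    (Hij : gen_bus D i = gen_bus D j) (Hjl : gen_bus D j = load_bus D l)
    (Hi : has_eta_g D d x i) (Hj : has_eta_g D d x j)
    (Hl : has_eta_d D d x h l) :
  eta_g D d x i = eta_g D d x j /\ eta_g D d x j = eta_d D d x h l.
Proof.
rewrite (eta_gE Hopt Hi) (eta_gE Hopt Hj) (eta_dE Hopt Hl).
by split; [exact: gen_price_bus | exact: gen_load_price_bus].
Qed.
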